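(* Let $n\ge 2$, let $A_1,\ldots,A_n$ be pairwise disjoint compact subintervals of $(0,1)$, and for each $1\le i\le n$ let $\phi_i:[0,1]\to A_i$ be a $C^2$-diffeomorphism (onto $A_i$) with $\sup_{0<x<1}|D\phi_i(x)|<1$. Let $\Omega=\{(x_1,\ldots,x_{n-1}) \mid 0<x_1<\cdots<x_{n-1}<1\}$. Then for Lebesgue almost every $(x_1,\ldots,x_{n-1})\in\Omega$, every map $f=f_{x_1,\ldots,x_{n-1}}$ (that is, every one of the $2^{n-1}$ piecewise contractions associated with $(x_1,\ldots,x_{n-1})$) has $r$ stable periodic orbits $\gamma_1,\ldots,\gamma_r$, for some $1\le r\le n$, such that $\omega(x)\in\{\gamma_1,\ldots,\gamma_r\}$ for every $x\in[0,1)$.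
   Context: Given $(x_1,\ldots,x_{n-1})\in\Omega$, put $x_0=0$ and $x_n=1$. Let $I_1,\ldots,I_n$ be a partition of $[0,1)$ into subintervals such that $I_i$ has interior $(x_{i-1},x_i)$; there are $2^{n-1}$ such partitions, since each $x_i$ with $1\le i\le n-1$ may belong to either $I_i$ or $I_{i+1}$. For each such partition, $f_{x_1,\ldots,x_{n-1}}:[0,1)\to[0,1)$ denotes the map defined by $f_{x_1,\ldots,x_{n-1}}(x)=\phi_i(x)$ for every $x\in I_i$ and $1\le i\le n$. Thus $2^{n-1}$ maps are associated with each $(x_1,\ldots,x_{n-1})$. A finite set $\gamma\subseteq[0,1)$ is a periodic orbit of $f$ if there exist $p\in[0,1)$ and an integer $k\ge1$ such that $f^k(p)=p$ and $\gamma=\{p,f(p),\ldots,f^{k-1}(p)\}$. A periodic orbit $\gamma$ of $f_{x_1,\ldots,x_{n-1}}$ is stable if $\gamma\subseteq[0,1)\setminus\{x_1,\ldots,x_{n-1}\}$. The $\omega$-limit set of $x\in[0,1)$ is $\omega(x)=\bigcap_{m\ge0}\overline{\bigcup_{k\ge m}\{f^k(x)\}}$, where the bar denotes topological closure. *)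

(* Defs.v *)
From HB Require Import structures.
From mathcomp Require Import all_boot all_order all_algebra.
From mathcomp Require Import all_classical all_reals all_analysis.

Set Implicit Arguments.
Unset Strict Implicit.
Unset Printing Implicit Defensive.

Import Order.TTheory GRing.Theory Num.Theory.
Import numFieldNormedType.Exports.

Local Open Scope classical_set_scope.
Local Open Scope ring_scope.

(* Lebesgue outer measure on R^m: infimum of the total volumes of the countable
   covers by closed boxes. *)

Definition box (R : realType) (m : nat) (a b : 'rV[R]_m) : set 'rV[R]_m :=
  [set x | forall i, a ord0 i <= x ord0 i <= b ord0 i].

Definition box_volume (R : realType) (m : nat) (a b : 'rV[R]_m) : R :=
  \prod_(i < m) (b ord0 i - a ord0 i).

Definition lebesgue_outer (R : realType) (m : nat) (N : set 'rV[R]_m) : \bar R :=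
  ereal_inf [set v | exists a b : nat -> 'rV[R]_m,
    [/\ forall k i, a k ord0 i <= b k ord0 i,
        N `<=` \bigcup_k box (a k) (b k) &
        v = (\sum_(0 <= k <oo) (box_volume (a k) (b k))%:E)%E]].

Definition lebesgue_ae_in (R : realType) (m : nat) (D : set 'rV[R]_m)
    (P : 'rV[R]_m -> Prop) : Prop :=
  lebesgue_outer (D `&` [set x | ~ P x]) = 0%E.

(* Differentiation relative to a set, so that derivatives at the end points of
   a closed interval are one-sided and do not depend on values outside it. *)

Definition is_derive_within (R : realType) (A : set R) (f : R -> R) (x l : R) :
    Prop :=
  (f y - f x) / (y - x) @[y --> within A x^'] --> l.

Definition C2_on (R : realType) (A : set R) (f : R -> R) : Prop :=
  exists f1 f2 : R -> R,
    [/\ forall x, A x -> is_derive_within A f x (f1 x),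
        forall x, A x -> is_derive_within A f1 x (f2 x) &
        {within A, continuous f2}].

Definition C2_diffeo (R : realType) (A B : set R) (f : R -> R) : Prop :=
  [/\ set_bij A B f, C2_on A f &
      exists2 g : R -> R, (forall x, A x -> g (f x) = x) & C2_on B g].

(* x_0 = 0, x_n = 1 and, for 1 <= k <= n-1, x_k is the coordinate of index k-1
   of x. *)
Definition knot (R : realType) (n : nat) (x : 'rV[R]_n.-1) (k : nat) : R :=
  if k is k'.+1 then oapp (x ord0) 1 (insub k') else 0.

Definition Omega (R : realType) (n : nat) : set 'rV[R]_n.-1 :=
  [set x | forall k, (k < n)%N -> knot x k < knot x k.+1].

(* The index i : 'I_n, counted from 0, stands for i+1 in x_1, ..., x_n. *)
Definition knot_partition (R : realType) (n : nat) (x : 'rV[R]_n.-1)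
    (I : 'I_n -> set R) : Prop :=
  [/\ forall i, is_interval (I i),
      forall i, (I i)° = `]knot x i, knot x i.+1[%classic,
      trivIset setT I &
      \bigcup_i I i = `[0, 1[%classic].

(* The maps [0,1) -> [0,1) associated with x are represented by total functions
   whose values outside [0,1) are irrelevant. *)
Definition associated_map (R : realType) (n : nat) (phi : 'I_n -> R -> R)
    (x : 'rV[R]_n.-1) (f : R -> R) : Prop :=
  exists2 I : 'I_n -> set R, knot_partition x I &
    forall i y, I i y -> f y = phi i y.

Definition periodic_orbit (R : realType) (f : R -> R) (g : set R) : Prop :=
  exists (p : R) (k : nat), [/\ p \in `[0, 1[, (1 <= k)%N, iter k f p = p &
                  g = [set iter j f p | j in `I_k]].

Definition stable_periodic_orbit (R : realType) (n : nat) (x : 'rV[R]_n.-1)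
    (f : R -> R) (g : set R) : Prop :=
  periodic_orbit f g /\ g `<=` `[0, 1[ `\` range (x ord0).

Definition omega_limit (R : realType) (f : R -> R) (x : R) : set R :=
  \bigcap_m closure [set iter k f x | k in [set k | (m <= k)%N]].

(* Main.v *)
(* Let lam < 1 be a common contraction rate of the branches, phi_w the composition
   of branches along a word w, and level k the union of the intervals
   phi_w([0,1]) with |w| = k, so that f^k maps [0,1) into level k.  The C^2
   hypothesis gives bounded distortion: the image under phi_w of the gap below
   all the A_i is a definite proportion of phi_w([0,1]), hence the total length of
   the intervals of level k decays geometrically, and for almost every x no
   coordinate of x lies in all the levels.

   For such an x some closed level K is at distance d > 0 from all the x_j, and
   two orbits that are d-close, one of them in level K, stay in common pieces and
   are contracted together.  An orbit returns d-close to itself, hence converges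
   to a periodic orbit in level K, and omega is locally constant near level K.

   To bound the number r of values of omega, consider the real functions c of
   these values that agree on the two one-sided germs of omega at each x_j; they
   are the solutions of n-1 linear equations in r unknowns.  Pulling back from
   level K, c o omega is locally constant on [0,1), so c is constant; hence
   r - (n-1) <= 1. *)

Require Import Defs.
From mathcomp Require Import all_boot all_order all_algebra.
From mathcomp Require Import all_classical all_reals all_analysis.
From mathcomp Require Import ring lra zify.

Set Implicit Arguments.
Unset Strict Implicit.
Unset Printing Implicit Defensive.

Import Order.TTheory GRing.Theory Num.Theory.
Import numFieldNormedType.Exports.

Local Open Scope classical_set_scope.
Local Open Scope ring_scope.

(** * Derivatives relative to an interval *)

Section WithinDerivative.
Context {R : realType}.
Implicit Types (A B : set R) (f g : R -> R) (a b x y l : R).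

(** Clearing the denominator turns the limit over punctured neighbourhoods into a linear estimate
    that also covers [y = x]. *)
Lemma is_derive_withinP A f x l :
  is_derive_within A f x l <->
  forall e, 0 < e -> exists2 d, 0 < d &
    forall y, A y -> `|y - x| < d -> `|f y - f x - l * (y - x)| <= e * `|y - x|.
Proof.
split.
- move=> /cvgrPdist_le df e e0; have /(_ _ e0) := df.
  move=> /nbhs_ballP[d /= d0 H]; exists d => // y Ay yd.
  have [->|yx] := eqVneq y x; first by rewrite !subrr mulr0 subrr normr0 mulr0.
  have yx0 : y - x != 0 by rewrite subr_eq0.
  have : `|l - (f y - f x) / (y - x)| <= e.
    by apply: H => //; rewrite -ball_normE/= distrC.
  move=> le1.
  rewrite -[X in X - l * _](divfK yx0) -mulrBl normrM ler_wpM2r//.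
  by rewrite distrC.
- move=> df; apply/cvgrPdist_le => e e0.
  have [d d0 H] := df e e0.
  apply/nbhs_ballP; exists d => //= y + yx Ay.
  rewrite -ball_normE/= distrC => yd.
  have yx0 : y - x != 0 by rewrite subr_eq0.
  have := H y Ay yd.
  rewrite -ler_pdivrMr ?normr_gt0// -normf_div mulrBl mulfK//.
  by rewrite distrC.
Qed.

Lemma is_derive_within_continuous A f f1 :
  (forall x, A x -> is_derive_within A f x (f1 x)) -> {within A, continuous f}.
Proof.
move=> df; apply/subspace_continuousP => x Ax.
apply/cvgrPdist_le => e e0; rewrite near_withinE.
have /is_derive_withinP/(_ _ ltr01)[d d0 H] := df x Ax.
set M := `|f1 x| + 1.
have M0 : 0 < M by rewrite ltr_wpDl.
apply/nbhs_ballP; exists (Num.min d (e / M)) => /=.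
  by rewrite lt_min d0 divr_gt0.
move=> y; rewrite -ball_normE/= distrC lt_min ltr_pdivlMr//.
move=> /andP[yd ye] Ay; rewrite distrC.
have := H y Ay yd; rewrite mul1r => H1.
rewrite -[f y - f x](subrK (f1 x * (y - x))).
apply: le_trans (ler_normD _ _) _; rewrite normrM.
apply: le_trans (lerD H1 (lexx _)) _.
by move: ye; rewrite /M; lra.
Qed.

Lemma is_derive_within_interior A f x l d : 0 < d ->
  (forall y, `|y - x| < d -> A y) -> is_derive_within A f x l ->
  is_derive x 1 f l.
Proof.
move=> d0 Ad /is_derive_withinP df.
suff H : (fun h => h^-1 *: (f (h *: 1 + x) - f x)) @ (0:R)^' --> l.
  by split; [exact: cvgP H|exact: (cvg_lim _ H)].
apply/cvgrPdist_le => e e0; have [d' d'0 H] := df e e0.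
apply/nbhs_ballP; exists (Num.min d d') => /=; first by rewrite lt_min d0.
move=> h; rewrite -ball_normE/= sub0r normrN lt_min.
move=> /andP[hd hd'] h0.
have E : h *: 1 + x - x = h by rewrite addrK /GRing.scale/= mulr1.
have := H (h *: 1 + x); rewrite E => /(_ _ hd') H1.
rewrite -(ler_pM2r (x := `|h|)) ?normr_gt0// -normrM.
rewrite mulrBl /GRing.scale/= (mulrC h^-1) divfK// distrC.
by apply: H1; apply: Ad; rewrite E.
Qed.

Lemma MVT_within A f f1 a b :
  (forall x, A x -> is_derive_within A f x (f1 x)) ->
  a < b -> `[a, b] `<=` A ->
  exists2 c, c \in `]a, b[ & f b - f a = f1 c * (b - a).
Proof.
move=> df ab abA.
apply: MVT => //; last first.
  apply: continuous_subspaceW abA _; exact: is_derive_within_continuous df.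
move=> x; rewrite in_itv/= => /andP[ax xb].
apply: (is_derive_within_interior (A := A) (d := Num.min (x - a) (b - x))).
- by rewrite lt_min !subr_gt0 ax.
- move=> y; rewrite lt_min !ltr_distl => /andP[/andP[h1 h2] /andP[h3 h4]].
  by apply: abA; rewrite /= in_itv/=; apply/andP; split; lra.
- by apply: df; apply: abA; rewrite /= in_itv/= !ltW.
Qed.

(** Absolute values make the order of [x] and [y] irrelevant. The strict bounds keep [c] off the end
    points, where [branch_contraction] has no bound on the derivative. *)
Lemma MVT_within_norm A f f1 x y : is_interval A ->
  (forall x, A x -> is_derive_within A f x (f1 x)) ->
  A x -> A y -> x != y ->
  exists c, [/\ Num.min x y < c, c < Num.max x y, A c &
    `|f y - f x| = `|f1 c| * `|y - x|].
Proof.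
move=> iA df; wlog xy : x y / x < y => [H Ax Ay xy|Ax Ay _].
  have [xy'|yx|E] := ltgtP x y.
  + by have := H x y xy' Ax Ay xy; rewrite minElt maxElt xy'.
  + have [|c [c1 c2 Ac E]] := H y x yx Ay Ax _; first by rewrite eq_sym.
    exists c; split => //.
    - by move: c1; rewrite minElt yx.
    - by move: c2; rewrite maxElt yx.
    - by rewrite distrC E distrC.
  + by move: xy; rewrite E eqxx.
have [c + E] := MVT_within df xy (fun z zxy => iA x y Ax Ay z zxy).
rewrite in_itv/= => /andP[xc cy].
exists c; rewrite minElt maxElt xy; split => //.
- by apply: (iA x y Ax Ay); rewrite (ltW xc) ltW.
- by rewrite E normrM.
Qed.

Lemma is_derive_within_lipschitz A f f1 (L : R) : is_interval A ->
  (forall x, A x -> is_derive_within A f x (f1 x)) ->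
  (forall x, A x -> `|f1 x| <= L) ->
  forall x y, A x -> A y -> `|f y - f x| <= L * `|y - x|.
Proof.
move=> iA df bf1 x y Ax Ay.
have [->|xy] := eqVneq x y; first by rewrite !subrr normr0 mulr0.
have [c [_ _ Ac ->]] := MVT_within_norm iA df Ax Ay xy.
by rewrite ler_wpM2r// bf1.
Qed.

Lemma compact_within_bounded A f : compact A -> {within A, continuous f} ->
  exists2 M, 0 < M & forall x, A x -> `|f x| <= M.
Proof.
move=> cA cf; have [M [_ H]] := compact_bounded (continuous_compact cf cA).
exists (Num.max 1 (M + 1)); first by rewrite lt_max ltr01.
move=> x Ax; have := H (Num.max 1 (M + 1)); apply; last by exists x.
by rewrite lt_max ltrDl ltr01 orbT.
Qed.

Lemma C2_on_lipschitz A f : is_interval A -> compact A -> C2_on A f ->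
  exists L f1, [/\ 0 < L, forall x, A x -> is_derive_within A f x (f1 x),
    forall x y, A x -> A y -> `|f y - f x| <= L * `|y - x| &
    forall x y, A x -> A y -> `|f1 y - f1 x| <= L * `|y - x|].
Proof.
move=> iA cA [f1 [f2 [df df1 cf2]]].
have [M1 M10 b1] := compact_within_bounded cA (is_derive_within_continuous df1).
have [M2 M20 b2] := compact_within_bounded cA cf2.
exists (Num.max M1 M2), f1; split=> //; first by rewrite lt_max M10.
- move=> x y; apply: (is_derive_within_lipschitz iA df) => z Az.
  by rewrite le_max b1.
- move=> x y; apply: (is_derive_within_lipschitz iA df1) => z Az.
  by rewrite le_max b2 ?orbT.
Qed.

End WithinDerivative.

(** * A single branch *)

Section Branch.
Context {R : realType}.
Implicit Types (f phi : R -> R).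

Definition contraction_on01 lam phi := forall x y : R, 0 <= x <= 1 -> 0 <= y <= 1 ->
  `|phi x - phi y| <= lam * `|x - y|.

Definition strictly_monotone01 sg phi := forall x y : R, 0 <= x <= 1 -> 0 <= y <= 1 ->
  x < y -> 0 < sg * (phi y - phi x).

(** Bounded distortion: the slopes of two chords inside [[s, t]] have ratio at most [K (t - s)]. The
    multiplied form admits degenerate chords and composes along words without a chain rule. *)
Definition distortion01 (K : R -> R) phi := forall s t x y u v : R, 0 <= s -> t <= 1 ->
  s <= x <= t -> s <= y <= t -> s <= u <= t -> s <= v <= t ->
  `|phi u - phi v| * `|x - y| <= K (t - s) * (`|phi x - phi y| * `|u - v|).

Lemma branch_contraction (B : set R) phi : C2_diffeo `[0, 1] B phi ->
  (ereal_sup [set `|phi^`()%classic x|%:E | x in `]0%R, 1%R[] < 1)%E ->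
  exists lam, [/\ 0 <= lam, lam < 1 & contraction_on01 lam phi].
Proof.
move=> [_ [f1 [_ [df _ _]]] _] sup1.
have dE (x : R) : 0 < x -> x < 1 -> phi^`()%classic x = f1 x.
  move=> x0 x1.
  have := @is_derive_within_interior _ `[0, 1] phi x (f1 x) (Num.min x (1 - x)).
  move=> H; rewrite derive1E; apply: derive_val; apply: H.
  - by rewrite lt_min x0 subr_gt0.
  - move=> y; rewrite lt_min !ltr_distl => /andP[/andP[h1 h2] /andP[h3 h4]].
    by rewrite /= in_itv/=; apply/andP; split; lra.
  - by apply: df; rewrite /= in_itv/= !ltW.
set S := ereal_sup _ in sup1.
have leS (x : R) : 0 < x -> x < 1 -> (`|f1 x|%:E <= S)%E.
  move=> x0 x1; apply: ereal_sup_ubound; exists x; first by rewrite /= in_itv/= x0.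
  by rewrite dE.
(* The supremum is below 1 and at least [|f1 (1/2)|], so its real value can serve as [lam]. *)
have Sfin : S \is a fin_num.
  rewrite fin_numE; apply/andP; split.
    have := @leS 2^-1; rewrite invr_gt0 ltr0n invf_lt1 ?ltr1n// => /(_ isT isT).
    by case: S {sup1 leS}.
  by case: S {leS} sup1.
exists (fine S); rewrite -!lee_fin -lte_fin fineK//; split => //.
  by apply: le_trans (leS 2^-1 _ _); rewrite ?lee_fin// ?invf_lt1 ?ltr1n// invr_gt0.
move=> x y x01 y01; have [->|xy] := eqVneq x y; first by rewrite !subrr normr0 mulr0.
have in01 (z : R) : 0 <= z <= 1 -> `[0, 1]%classic z by rewrite /= in_itv/=.
have [c [c1 c2 _]] :=
  MVT_within_norm (@interval_is_interval _ `[0, 1]) df (in01 _ x01) (in01 _ y01) xy.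
rewrite distrC => ->; rewrite distrC ler_wpM2r//.
rewrite -lee_fin fineK//; apply: leS.
- by apply: le_lt_trans c1; rewrite le_min; case/andP: x01 => ->; case/andP: y01 => ->.
- apply: lt_le_trans c2 _; rewrite ge_max.
  by case/andP: x01 => _ ->; case/andP: y01 => _ ->.
Qed.

Lemma branch_monotone (B : set R) phi : C2_diffeo `[0, 1] B phi ->
  exists2 sg : R, sg = 1 \/ sg = -1 & strictly_monotone01 sg phi.
Proof.
move=> [[_ inj_phi _] [f1 [_ [df _ _]]] _].
have [] := @itv_continuous_inj_mono _ phi `[0, 1]%R.
- exact: is_derive_within_continuous df.
- by move=> x y x01 y01; apply: inj_phi; rewrite inE.
- move=> H; exists 1; [by left|move=> x y x01 y01 xy].
  by rewrite mul1r subr_gt0 (H x y).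
- move=> H; exists (-1); [by right|move=> x y x01 y01 xy].
  by rewrite mulN1r opprB subr_gt0 (H y x).
Qed.

(** By the mean value theorem the two slopes are [|f1 c|] and [|f1 e|]. If [f1] is [L]-Lipschitz,
    then [|f1 c| <= |f1 e| + L (t - s)]; if the inverse is [M]-Lipschitz, then [1 <= M |f1 e|]. So
    the ratio is at most [1 + L M (t - s)]. *)
Lemma branch_distortion (B : set R) phi : is_interval B -> compact B ->
  C2_diffeo `[0, 1] B phi ->
  exists2 C, 0 <= C & distortion01 (fun d => 1 + C * d) phi.
Proof.
move=> iB cB [[funB _ _] C2phi [g gK C2g]].
have i01 := @interval_is_interval R `[0, 1].
have [L [f1 [L0 df _ lf1]]] := C2_on_lipschitz i01 (@segment_compact R 0 1) C2phi.
have [M [_ [M0 _ lg _]]] := C2_on_lipschitz iB cB C2g.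
exists (L * M); first by rewrite mulr_ge0// ltW.
move=> s t x y u v s0 t1 xst yst ust vst.
have in01 z : s <= z <= t -> `[0, 1]%classic z.
  by move=> /andP[sz zt]; rewrite /= in_itv/= (le_trans s0 sz) (le_trans zt t1).
have [->|uv] := eqVneq u v.
  by rewrite !subrr normr0 mul0r !mulr0.
have [->|xy] := eqVneq x y.
  by rewrite !subrr normr0 mul0r !mulr0.
have between z w c : s <= z <= t -> s <= w <= t ->
    Num.min z w < c -> c < Num.max z w -> s <= c <= t.
  move=> /andP[sz zt] /andP[sw wt] zc cw; apply/andP; split.
    by apply: le_trans (ltW zc); rewrite le_min sz.
  by apply: le_trans (ltW cw) _; rewrite ge_max zt.
have [c [c1 c2 c01 Ec]] := MVT_within_norm i01 df (in01 _ ust) (in01 _ vst) uv.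
have [e [e1 e2 e01 Ee]] := MVT_within_norm i01 df (in01 _ xst) (in01 _ yst) xy.
have cst := between _ _ _ ust vst c1 c2.
have est := between _ _ _ xst yst e1 e2.
rewrite (distrC (phi u)) Ec (distrC (phi x)) Ee (distrC u) (distrC x).
have xy0 : 0 < `|y - x| by rewrite normr_gt0 subr_eq0 eq_sym.
have f1e : 1 <= M * `|f1 e|.
  rewrite -(ler_pM2r xy0) -mulrA -Ee mul1r.
  have := lg _ _ (funB _ (in01 _ xst)) (funB _ (in01 _ yst)).
  by rewrite !gK //; exact: in01.
have f1c : `|f1 c| <= `|f1 e| + L * (t - s).
  rewrite -[f1 c](subrK (f1 e)) addrC (le_trans (ler_normD _ _))// lerD2l.
  apply: le_trans (lf1 _ _ e01 c01) _; rewrite ler_wpM2l ?(ltW L0)//.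
  by rewrite ler_norml; move: cst est; lra.
have st : 0 <= t - s by move: xst; lra.
rewrite -!mulrA [X in _ <= _ * (_ * X)]mulrC !mulrA ler_wpM2r// ler_wpM2r//.
rewrite mulrDl mul1r (le_trans f1c)// lerD2l.
have -> : L * M * (t - s) * `|f1 e| = L * (t - s) * (M * `|f1 e|) by ring.
by rewrite ler_peMr// mulr_ge0// ltW.
Qed.

End Branch.

(** * Compositions of branches *)

Section Separated.
Context {R : realType}.

Lemma finite_pos_lower_bound (I : finType) (F : I -> R) :
  (forall i, 0 < F i) -> exists2 d, 0 < d & forall i, d <= F i.
Proof.
move=> F0; exists (\big[Num.min/1]_i F i); last by move=> i; exact: bigmin_le.
by apply: lt_bigmin => // i _.
Qed.

Lemma finite_upper_bound (I : finType) (F : I -> R) (x0 : R) :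
  exists2 M, x0 <= M & forall i, F i <= M.
Proof.
exists (\big[Num.max/x0]_i F i); last by move=> i; exact: le_bigmax.
exact: bigmax_ge_id.
Qed.

(** Induction on the number of intervals: once the one with the largest left end point [a i] is
    removed, the others lie in [[s, a i]]. *)
Lemma sum_disjoint_intervals (I : finType) (a b : I -> R) (D : {set I}) (s t : R) :
  s <= t -> {in D, forall i, [/\ s <= a i, a i <= b i & b i <= t]} ->
  {in D &, forall i j, i != j -> b i < a j \/ b j < a i} ->
  \sum_(i in D) (b i - a i) <= t - s.
Proof.
move: {2}#|D| (erefl #|D|) => k; elim: k => [|k IH] in D t *.
  by move=> /eqP; rewrite cards_eq0 => /eqP-> st _ _; rewrite big_set0 subr_ge0.
move=> cD st abD disj.
have [i0 i0D] : exists i, i \in D by apply/card_gt0P; rewrite cD.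
case: (@arg_maxP _ _ _ i0 [in D] a i0D) => i iD amax.
rewrite (big_setD1 i iD)/=.
have [sai abi bit] := abD _ iD.
have cDi : #|D :\ i| = k by move: cD; rewrite (cardsD1 i) iD => -[].
suff : \sum_(j in D :\ i) (b j - a j) <= a i - s.
  by move: sai abi bit; lra.
apply: IH => //.
- move=> j /setD1P[ji jD]; have [-> -> _] := abD _ jD; split => //.
  have [/ltW//|bj] := disj _ _ jD iD ji.
  have /= h := amax _ jD; exfalso; move: abi bj h; lra.
- by move=> j l /setD1P[_ jD] /setD1P[_ lD]; exact: disj.
Qed.

End Separated.

Section Words.
Context {R : realType} {n : nat}.
Variable phi : 'I_n -> R -> R.

(** The head of the word acts first, so the interval of [i :: w] lies inside that of [w]. *)
Definition word_map (w : seq 'I_n) (x : R) := foldl (fun x i => phi i x) x w.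

Fixpoint words (k : nat) : seq (seq 'I_n) :=
  if k is k'.+1 then [seq i :: w | i <- enum 'I_n, w <- words k'] else [:: [::]].

Lemma mem_words w k : (w \in words k) = (size w == k).
Proof.
elim: k w => [|k IH] [|i w] //=.
- by apply/negbTE/negP => /allpairsP[[? ?] []].
- rewrite eqSS -IH; apply/allpairsP/idP; first by case=> -[j v] [_ vk [_ ->]].
  by exists (i, w); rewrite mem_enum.
Qed.

Lemma word_map_rcons w i x : word_map (rcons w i) x = phi i (word_map w x).
Proof. by rewrite /word_map foldl_rcons. Qed.

Hypothesis phi01 : forall i x, 0 <= x <= 1 -> 0 <= phi i x <= 1.

Lemma word_map01 w x : 0 <= x <= 1 -> 0 <= word_map w x <= 1.
Proof. by elim: w x => [|i w IH] x //= x01; apply/IH/phi01. Qed.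

Hypothesis phi_mono :
  forall i, exists2 sg : R, sg = 1 \/ sg = -1 & strictly_monotone01 sg (phi i).

Lemma word_map_mono w :
  exists2 sg : R, sg = 1 \/ sg = -1 & strictly_monotone01 sg (word_map w).
Proof.
elim: w => [|i w [s s1 ms]].
  by exists 1; [left|move=> x y _ _; rewrite mul1r subr_gt0].
have [r r1 mr] := phi_mono i.
exists (r * s).
  by case: s1 r1 => -> [] ->; rewrite ?mulr1 ?mul1r ?mulrNN ?mulr1;
    [left|right|right|left].
move=> x y x01 y01 xy /=; have := mr x y x01 y01 xy.
case: r1 => ->; rewrite ?mul1r ?mulN1r ?oppr_gt0 ?(subr_gt0, subr_lt0) => h.
- by apply: ms => //; exact: phi01.
- by rewrite mulNr -mulrN opprB; apply: ms => //; exact: phi01.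
Qed.

Lemma monotone01_neq sg (h : R -> R) (x y : R) : strictly_monotone01 sg h ->
  0 <= x <= 1 -> 0 <= y <= 1 -> x != y -> h x != h y.
Proof.
move=> mh x01 y01; apply: contra => /eqP hxy.
case: (ltgtP x y) => // xy.
- by have := mh _ _ x01 y01 xy; rewrite hxy subrr mulr0 ltxx.
- by have := mh _ _ y01 x01 xy; rewrite hxy subrr mulr0 ltxx.
Qed.

Lemma monotone01_between (h : R -> R) sg s x t : sg = 1 \/ sg = -1 ->
  strictly_monotone01 sg h -> 0 <= s -> t <= 1 -> s <= x <= t ->
  Num.min (h s) (h t) <= h x <= Num.max (h s) (h t).
Proof.
move=> sg1 mh s0 t1 /andP[sx xt].
have s1 : 0 <= s <= 1 by lra.
have x1 : 0 <= x <= 1 by lra.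
have t01 : 0 <= t <= 1 by lra.
have H1 : 0 <= sg * (h x - h s).
  have [<-|ns] := eqVneq s x; first by rewrite subrr mulr0.
  by apply/ltW/mh => //; rewrite lt_neqAle ns.
have H2 : 0 <= sg * (h t - h x).
  have [<-|ns] := eqVneq x t; first by rewrite subrr mulr0.
  by apply/ltW/mh => //; rewrite lt_neqAle ns.
rewrite ge_min le_max; case: sg1 H1 H2 => ->; rewrite ?mul1r ?mulN1r => H1 H2.
- have -> : h s <= h x by lra.
  have -> : h x <= h t by lra.
  by rewrite orbT.
- have -> : h t <= h x by lra.
  have -> : h x <= h s by lra.
  by rewrite orbT.
Qed.

Variables (lam C : R).
Hypotheses (lam1 : lam < 1) (C0 : 0 <= C).
Hypothesis phi_lam : forall i, contraction_on01 lam (phi i).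
Hypothesis phi_dist : forall i, distortion01 (fun d => 1 + C * d) (phi i).

Let E d := expR (C / (1 - lam) * d).

Lemma E_ge1 d : 0 <= d -> 1 <= E d.
Proof.
move=> d0; rewrite -[X in X <= _]expR0 ler_expR.
by rewrite mulr_ge0// divr_ge0// subr_ge0 ltW.
Qed.

(* The factors 1 + C lam^j (t - s) collected along the word multiply to at most
   exp (C (t - s) (1 + lam + lam^2 + ...)). *)
Lemma word_map_distortion w : distortion01 E (word_map w).
Proof.
have lam10 : 0 < 1 - lam by rewrite subr_gt0.
elim: w => [|i w IH] s t x y u v s0 t1 xst yst ust vst /=.
  rewrite mulrC ler_peMl// ?mulr_ge0// /E.
  by apply: E_ge1; move: xst; lra.
have [sg sg1 mg] := phi_mono i.
have betw z : s <= z <= t ->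
    Num.min (phi i s) (phi i t) <= phi i z <= Num.max (phi i s) (phi i t).
  exact: monotone01_between sg1 mg s0 t1.
have st : s <= t by move: xst; lra.
have s01 : 0 <= s <= 1 by rewrite s0 (le_trans st).
have t01 : 0 <= t <= 1 by rewrite t1 (le_trans s0).
(* By monotonicity the hull of [phi i s] and [phi i t] contains the images of all four points; by
   contraction its length is at most [lam * (t - s)]. *)
have := IH (Num.min (phi i s) (phi i t)) (Num.max (phi i s) (phi i t))
  (phi i x) (phi i y) (phi i u) (phi i v).
have [ps0 ps1] := andP (phi01 i s01); have [pt0 pt1] := andP (phi01 i t01).
rewrite le_min ps0 pt0 ge_max ps1 pt1 => /(_ isT isT).
move=> /(_ (betw _ xst) (betw _ yst) (betw _ ust) (betw _ vst)).
have -> : Num.max (phi i s) (phi i t) - Num.min (phi i s) (phi i t) =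
    `|phi i t - phi i s|.
  rewrite maxElt minElt; case: ltP => h; first by rewrite gtr0_norm ?subr_gt0.
  by rewrite ler0_norm ?opprB// subr_le0.
set e := `|phi i t - phi i s| => H.
have ele : e <= lam * (t - s).
  by have := @phi_lam i _ _ t01 s01; rewrite (ger0_norm (x := t - s)) ?subr_ge0.
have D := @phi_dist i _ _ _ _ _ _ s0 t1 xst yst ust vst.
have [->|uv] := eqVneq u v; first by rewrite !subrr normr0 mul0r !mulr0.
have [->|xy] := eqVneq x y; first by rewrite !subrr normr0 mul0r !mulr0.
set hx := word_map w (phi i x) in H *; set hy := word_map w (phi i y) in H *.
set hu := word_map w (phi i u) in H *; set hv := word_map w (phi i v) in H *.
have injphi (p q : R) : 0 <= p <= 1 -> 0 <= q <= 1 -> p != q -> 0 < `|phi i p - phi i q|.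
  by move=> p01 q01 pq; rewrite normr_gt0 subr_eq0 (monotone01_neq mg).
have in01 (p : R) : s <= p <= t -> 0 <= p <= 1 by lra.
have puv := injphi _ _ (in01 _ ust) (in01 _ vst) uv.
have pxy := injphi _ _ (in01 _ xst) (in01 _ yst) xy.
(* After multiplication by the positive lengths of the intermediate chords, the goal follows from
   the product of [H] and [D]. *)
rewrite -(ler_pM2r pxy) -(ler_pM2r puv).
set X := `|hx - hy| in H *; set U := `|hu - hv| in H *.
set px := `|phi i x - phi i y| in H D pxy *; set pu := `|phi i u - phi i v| in H D puv *.
have -> : U * `|x - y| * px * pu = (U * px) * (pu * `|x - y|) by ring.
have -> : E (t - s) * (X * `|u - v|) * px * pu =
    E (t - s) * ((X * pu) * (px * `|u - v|)) by ring.
have e0 : 0 <= e by exact: normr_ge0.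
have X0 : 0 <= X by exact: normr_ge0.
have U0 : 0 <= U by exact: normr_ge0.
have [px0 pu0] := (ltW pxy, ltW puv).
apply: le_trans (ler_pM _ _ H D) _; rewrite ?mulr_ge0//.
rewrite mulrACA; apply: ler_wpM2r; first by rewrite !mulr_ge0.
rewrite /E.
have ts0 : 0 <= t - s by rewrite subr_ge0.
(* Here [1 + C d <= exp (C d)], and the exponents add up exactly, since
   [lam C / (1 - lam) + C = C / (1 - lam)]. *)
apply: (@le_trans _ _ (expR (C / (1 - lam) * (lam * (t - s))) * expR (C * (t - s)))).
  apply: ler_pM; rewrite ?expR_ge0//.
  - by rewrite addr_ge0// mulr_ge0.
  - by rewrite ler_expR ler_wpM2l// divr_ge0// ltW.
  - exact: expR_ge1Dx.
rewrite -expRD ler_expR.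
rewrite le_eqVlt; apply/orP; left; apply/eqP; field.
by rewrite gt_eqF.
Qed.

(** * Geometric decay of the total length of a level *)

Variable delta : R.
Hypotheses (delta0 : 0 < delta) (delta1 : delta <= 1).
Hypothesis phi_delta : forall i x, 0 <= x <= 1 -> delta <= phi i x.
Hypothesis phi_sep : forall i j, i != j ->
  Num.max (phi i 0) (phi i 1) < Num.min (phi j 0) (phi j 1) \/
  Num.max (phi j 0) (phi j 1) < Num.min (phi i 0) (phi i 1).

Definition word_length w := `|word_map w 1 - word_map w 0|.

(** The children are disjoint and lie in the image of [[delta, 1]]. They miss the image of
    [[0, delta]], which by bounded distortion makes up at least the proportion [delta / E 1] of the
    whole. *)
Lemma word_length_children w :
  \sum_(i < n) word_length (i :: w) <= (1 - delta / E 1) * word_length w.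
Proof.
have [sg sg1 mg] := word_map_mono w.
rewrite /word_length /=; set h := word_map w.
have z01 : 0 <= (0 : R) <= 1 by rewrite lexx ler01.
have o01 : 0 <= (1 : R) <= 1 by rewrite lexx ler01.
have d01 : 0 <= delta <= 1 by rewrite ltW.
(* Since [sg * h] is increasing, the end points are in the right order whatever the orientation of
   [h]. *)
pose a i := sg * h (Num.min (phi i 0) (phi i 1)).
pose b i := sg * h (Num.max (phi i 0) (phi i 1)).
have mh (x y : R) : 0 <= x <= 1 -> 0 <= y <= 1 -> x <= y -> sg * h x <= sg * h y.
  move=> x01 y01; rewrite le_eqVlt => /orP[/eqP->//|xy].
  by rewrite ltW// -subr_gt0 -mulrBr; exact: mg.
have sgn (x y : R) : sg * h x <= sg * h y -> sg * h y - sg * h x = `|h y - h x|.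
  move=> H; rewrite -[LHS]ger0_norm ?subr_ge0// -mulrBr normrM.
  by case: sg1 => ->; rewrite ?normrN normr1 mul1r.
have min01 i : 0 <= Num.min (phi i 0) (phi i 1) <= 1.
  by rewrite minElt; case: ifP => _; exact: phi01.
have max01 i : 0 <= Num.max (phi i 0) (phi i 1) <= 1.
  by rewrite maxElt; case: ifP => _; exact: phi01.
have mM i : Num.min (phi i 0) (phi i 1) <= Num.max (phi i 0) (phi i 1).
  by rewrite ge_min le_max lexx.
have -> : \sum_(i < n) `|h (phi i 1) - h (phi i 0)| =
    \sum_(i in [set: 'I_n]%SET) (b i - a i).
  apply: eq_big => [i|i _]; first by rewrite inE.
  rewrite /a /b sgn; last exact: mh.
  by rewrite maxElt minElt; case: ifP => // _; rewrite distrC.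
apply: (@le_trans _ _ (sg * h 1 - sg * h delta)).
  apply: sum_disjoint_intervals.
  - by apply: mh.
  - move=> i _; split; apply: mh => //.
    + by rewrite minElt; case: ifP => _; exact: phi_delta.
    + by case/andP: (max01 i).
  - move=> i j _ _ /phi_sep[H|H]; [left|right];
      by rewrite /a /b -subr_gt0 -mulrBr; apply: mg.
have E0 : 0 < E 1 by exact: expR_gt0.
have := @word_map_distortion w 0 1 delta 0 1 0 (lexx 0) (lexx 1) d01 z01 o01 z01.
rewrite -/h !subr0 normr1 mulr1 (gtr0_norm delta0) => H.
have : delta / E 1 * `|h 1 - h 0| <= `|h delta - h 0|.
  by rewrite mulrAC ler_pdivrMr// mulrC [X in _ <= X]mulrC.
rewrite -(sgn 0 1) ?mh// -(sgn 0 delta) ?mh//; last by rewrite ltW.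
by rewrite mulrBl mul1r; lra.
Qed.

Lemma sum_word_length k :
  \sum_(w <- words k) word_length w <= (1 - delta / E 1) ^+ k.
Proof.
elim: k => [|k IH].
  by rewrite big_seq1 expr0 /word_length /= subr0 normr1.
(* Exchanging the sums groups the words [i :: w] by their tail [w], that is, by parent. *)
rewrite big_allpairs_dep/= big_enum/= exchange_big/= exprS.
have E1 : 1 <= E 1 by exact: E_ge1.
have E0 : 0 < E 1 by exact: expR_gt0.
have rho0 : 0 <= 1 - delta / E 1.
  by rewrite subr_ge0 ler_pdivrMr// mul1r (le_trans delta1).
apply: le_trans (ler_wpM2l rho0 IH).
by rewrite mulr_sumr; apply: ler_sum => w _; exact: word_length_children.
Qed.

Lemma sum_word_length_cvg0 (e : R) : 0 < e ->
  exists k, \sum_(w <- words k) word_length w < e.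
Proof.
move=> e0.
have E1 : 1 <= E 1 by exact: E_ge1.
have E0 : 0 < E 1 by exact: expR_gt0.
have rho0 : 0 <= 1 - delta / E 1.
  by rewrite subr_ge0 ler_pdivrMr// mul1r (le_trans delta1).
have rho1 : `|1 - delta / E 1| < 1.
  by rewrite ger0_norm// gtrBl divr_gt0.
have /cvgrPdist_lt/(_ _ e0)[k _ /(_ _ (leqnn k))] := cvg_expr rho1.
rewrite sub0r normrN ger0_norm ?exprn_ge0// => H.
by exists k; apply: le_lt_trans H; exact: sum_word_length.
Qed.

End Words.

(** * Covers by slabs *)

Section OuterMeasure.
Context {R : realType} {m : nat}.
Implicit Types (N : set 'rV[R]_m) (a b : 'rV[R]_m).

Lemma box_volume_ge0 a b : (forall i, a ord0 i <= b ord0 i) -> 0 <= box_volume a b.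
Proof. by move=> ab; apply: prodr_ge0 => i _; rewrite subr_ge0. Qed.

Lemma lebesgue_outer_ge0 N : (0 <= lebesgue_outer N)%E.
Proof.
apply: le_ereal_inf_tmp => _ [a [b [ab _ ->]]].
by apply: nneseries_ge0 => k _ _; rewrite lee_fin box_volume_ge0.
Qed.

(** A finite cover is padded to a countable one by the box from 0 to 0, whose volume is 0 because
    [m] is positive; an empty product would be 1. *)
Lemma lebesgue_outer_le_finite N (s : seq ('rV[R]_m * 'rV[R]_m)) : (0 < m)%N ->
  (forall p, p \in s -> forall i, p.1 ord0 i <= p.2 ord0 i) ->
  (forall x, N x -> exists2 p, p \in s & box p.1 p.2 x) ->
  (lebesgue_outer N <= (\sum_(p <- s) box_volume p.1 p.2)%:E)%E.
Proof.
move=> m0 s_le Ns; pose c k := nth (0, 0) s k.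
have c_le k i : (c k).1 ord0 i <= (c k).2 ord0 i.
  have [ks|ks] := ltnP k (size s); first by apply: s_le; rewrite mem_nth.
  by rewrite /c nth_default.
apply: ereal_inf_lbound; exists (fun k => (c k).1), (fun k => (c k).2); split => //.
  move=> x /Ns[p ps px]; exists (index p s) => //=.
  by rewrite /c nth_index.
rewrite (nneseries_split 0 (size s)); last first.
  by move=> k _; rewrite lee_fin box_volume_ge0.
rewrite add0n eseries0 ?adde0; last first.
  move=> k ks _; rewrite /c nth_default//; congr (_%:E).
  rewrite /box_volume (bigD1 (Ordinal m0))//= subrr mul0r//.
by rewrite (big_nth (0, 0)) sumEFin.
Qed.

(** Each interval [p] and index [i] give a slab of the unit cube, with coordinate [i] in [p], whose
    volume is the length of [p]. An interval is used [m] times, so the cover is taken with total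
    length below [e / m]. *)
Lemma lebesgue_outer_slabs N : (0 < m)%N ->
  (forall x, N x -> forall i, 0 <= x ord0 i <= 1) ->
  (forall e : R, 0 < e -> exists s : seq (R * R),
    [/\ forall p, p \in s -> p.1 <= p.2, \sum_(p <- s) (p.2 - p.1) < e &
      forall x, N x -> exists i p, p \in s /\ p.1 <= x ord0 i <= p.2]) ->
  lebesgue_outer N = 0%E.
Proof.
move=> m0 N01 cover; apply/eqP; rewrite eq_le lebesgue_outer_ge0 andbT.
apply/lee_addgt0Pr => e e0; rewrite add0e.
have m0R : 0 < m%:R :> R by rewrite ltr0n.
have [s [s_le s_sum Ns]] := cover (e / m%:R) (divr_gt0 e0 m0R).
pose lo (q : 'I_m * (R * R)) : 'rV[R]_m := \row_i (if i == q.1 then q.2.1 else 0).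
pose hi (q : 'I_m * (R * R)) : 'rV[R]_m := \row_i (if i == q.1 then q.2.2 else 1).
pose boxes := [seq (lo q, hi q) | q <- [seq (i, p) | i <- enum 'I_m, p <- s]].
apply: (le_trans (lebesgue_outer_le_finite (s := boxes) m0 _ _)).
- move=> _ /mapP[q /allpairsP[[j p] /= [_ ps ->]] ->] i /=.
  by rewrite !mxE /=; case: ifP => // _; exact: s_le.
- move=> x Nx; have [i [p [ps xp]]] := Ns x Nx.
  exists (lo (i, p), hi (i, p)).
    by apply/map_f/allpairs_f => //; rewrite mem_enum.
  by move=> j; rewrite /= !mxE /=; case: eqP => [->//|_]; exact: N01.
- rewrite lee_fin /boxes big_map big_allpairs big_enum/=.
  have -> : \sum_(i < m) \sum_(p <- s) box_volume (lo (i, p)) (hi (i, p)) =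
            \sum_(i < m) \sum_(p <- s) (p.2 - p.1).
    apply: eq_bigr => i _; apply: eq_bigr => p _.
    rewrite /box_volume (bigD1 i)//= !mxE /= eqxx big1 ?mulr1//.
    by move=> j ji; rewrite !mxE /= (negbTE ji) subr0.
  rewrite sumr_const card_ord -mulr_natr -ler_pdivlMr//.
  exact: ltW.
Qed.

End OuterMeasure.

(** * Omega-limit sets *)

Section Orbits.
Context {R : realType}.
Implicit Types (f : R -> R) (x y z : R) (S : set R).

Lemma closureP_dist S z :
  closure S z <-> forall e, 0 < e -> exists2 y, S y & `|z - y| < e.
Proof.
split=> [Sz e e0|H B /nbhs_ballP[e /= e0 eB]].
  have [y [Sy]] := Sz _ (nbhsx_ballx z e e0).
  by rewrite -ball_normE => zy; exists y.
have [y Sy yz] := H e e0; exists y; split => //.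
by apply: eB; rewrite -ball_normE.
Qed.

Lemma closed_dist S z : closed S -> ~ S z ->
  exists2 d, 0 < d & forall y, S y -> d <= `|z - y|.
Proof.
move=> cS Sz; apply: contrapT => H; apply: Sz; apply: cS.
apply/closureP_dist => e e0; apply: contrapT => H'; apply: H; exists e => // y Sy.
by rewrite leNgt; apply/negP => zy; apply: H'; exists y.
Qed.

Lemma omega_limit_iterP f x z : omega_limit f x z <->
  forall m e, 0 < e -> exists2 k, (m <= k)%N & `|z - iter k f x| < e.
Proof.
split=> [H m e e0|H m _].
  have /closureP_dist/(_ e e0)[_ [k mk <-]] := H m I.
  by exists k.
apply/closureP_dist => e e0; have [k mk zk] := H m e e0.
by exists (iter k f x) => //; exists k.
Qed.

Lemma omega_limit_asymptotic f x y :
  (forall e, 0 < e -> exists m, forall k, (m <= k)%N -> `|iter k f x - iter k f y| < e) ->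
  omega_limit f x = omega_limit f y.
Proof.
wlog suff : x y / (forall e, 0 < e ->
    exists m, forall k, (m <= k)%N -> `|iter k f x - iter k f y| < e) ->
  omega_limit f x `<=` omega_limit f y.
  move=> H xy; apply/seteqP; split; apply: H => // e /xy[m H]; exists m => k /H.
  by rewrite distrC.
move=> xy z /omega_limit_iterP Hz; apply/omega_limit_iterP => m e e0.
have e20 : 0 < e / 2 by rewrite divr_gt0.
have [m' H] := xy _ e20; have [k] := Hz (maxn m m') _ e20.
rewrite geq_max => /andP[mk /H xyk] zk; exists k => //.
rewrite -[z - _](subrKA (iter k f x)) [ltRHS]splitr.
by rewrite (le_lt_trans (ler_normD _ _))// ltrD.
Qed.

Lemma omega_limit_iter f k x : omega_limit f (iter k f x) = omega_limit f x.
Proof.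
apply/seteqP; split=> z /omega_limit_iterP H; apply/omega_limit_iterP => m e e0.
  have [j mj zj] := H m e e0; exists (j + k)%N; first exact: leq_trans (leq_addr _ _).
  by rewrite iterD.
have [j mj zj] := H (m + k)%N e e0; exists (j - k)%N.
  by rewrite leq_subRL ?(leq_trans _ mj) ?leq_addl// addnC.
by rewrite -iterD subnK// (leq_trans _ mj)// leq_addl.
Qed.

Lemma iter_mod f p j x : (0 < p)%N -> iter p f x = x -> iter j f x = iter (j %% p) f x.
Proof.
move=> p0 px; rewrite {1}(divn_eq j p) addnC iterD; congr (iter _ f _).
by elim: (j %/ p)%N => //= k IH; rewrite mulSn iterD IH.
Qed.

Lemma omega_limit_periodic f p x : (0 < p)%N -> iter p f x = x ->
  omega_limit f x = [set iter j f x | j in `I_p].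
Proof.
move=> p0 px; set O := [set _ | _ in _].
have cO : closed O.
  have /accessible_finite_set_closed := hausdorff_accessible (@Rhausdorff R).
  by apply; exact/finite_image/finite_II.
apply/seteqP; split => [z /omega_limit_iterP H|_ [j jp <-]].
  apply: cO; apply/closureP_dist => e e0; have [k _ zk] := H 0%N e e0.
  exists (iter k f x) => //; exists (k %% p)%N; first by rewrite /= ltn_mod.
  by rewrite -iter_mod.
apply/omega_limit_iterP => m e e0; exists (j + m * p)%N.
  by rewrite (leq_trans (leq_pmulr m p0))// leq_addl.
rewrite [iter (_ + _) _ _](iter_mod _ p0 px) addnC modnMDl modn_small//.
by rewrite subrr normr0.
Qed.

(** Pigeonhole on the integer parts of [N * u k], where [1 / N < d]. The value [u k = 1] is allowed,
    so there are [N.+1] classes, and [N.+2] indices are taken. *)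
Lemma close_returns (u : nat -> R) (d : R) : (forall k, 0 <= u k <= 1) -> 0 < d ->
  exists i j, (i < j)%N /\ `|u j - u i| < d.
Proof.
move=> u01 d0; pose N := (Num.truncn d^-1).+1.
have N0 : 0 < N%:R :> R by rewrite ltr0n.
have Nd : d^-1 < N%:R by apply: truncnS_gt.
pose c (k : 'I_N.+2) : 'I_N.+1 := inord (Num.truncn (N%:R * u k)).
have cE k : c k = Num.truncn (N%:R * u k) :> nat.
  rewrite inordK// ltnS; have /andP[uk0 uk1] := u01 k.
  have Nu0 : 0 <= N%:R * u k by rewrite mulr_ge0.
  rewrite -(ler_nat R); apply: le_trans (_ : N%:R * u k <= _).
    by rewrite truncn_le.
  by rewrite ler_piMr.
have [i [j [ij]]] : exists i j, i != j /\ c i = c j.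
  apply: contrapT => H; suff /leq_card : injective c by rewrite !card_ord ltnn.
  move=> i j cij; apply/eqP; apply: contrapT => /negP ij; apply: H.
  by exists i, j.
wlog ij' : i j ij / (i < j)%N => [H cij|/(congr1 val)/=].
  have [ij'|ji|ij'] := ltngtP i j; first exact: H ij ij' cij.
    by apply: H ji (esym cij); rewrite eq_sym.
  by move: ij; rewrite (ord_inj ij') eqxx.
rewrite !cE => cij; exists i, j; split => //.
have Nu0 k : 0 <= N%:R * u k by rewrite mulr_ge0//; case/andP: (u01 k).
have := truncn_itv (Nu0 i); have := truncn_itv (Nu0 j); rewrite -cij.
rewrite -natr1; move: (_%:R) => t H1 H2.
have : `|N%:R * u j - N%:R * u i| < 1 by rewrite ltr_norml; apply/andP; split; lra.
rewrite -mulrBr normrM (gtr0_norm N0) mulrC -ltr_pdivlMr// => /lt_trans; apply.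
by rewrite div1r invf_plt// posrE.
Qed.

Lemma exprn_small (lam D e : R) : 0 <= lam -> lam < 1 -> 0 <= D -> 0 < e ->
  exists m, forall k, (m <= k)%N -> lam ^+ k * D < e.
Proof.
move=> lam0 lam1 D0 e0; have D1 : 0 < D + 1 by rewrite ltr_wpDl.
have nl : `|lam| < 1 by rewrite ger0_norm.
have /cvgrPdist_lt/(_ _ (divr_gt0 e0 D1))[m _ H] := cvg_expr nl.
exists m => k mk; have := H k mk.
rewrite sub0r normrN ger0_norm ?exprn_ge0// ltr_pdivlMr//.
by apply: le_lt_trans; rewrite ler_wpM2l ?exprn_ge0// lerDl.
Qed.

Lemma geometric_step_cvg (u : nat -> R) (lam d : R) : 0 <= lam -> lam < 1 -> 0 <= d ->
  (forall k, `|u k.+1 - u k| <= d * lam ^+ k) ->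
  exists l, forall e, 0 < e -> exists m, forall k, (m <= k)%N -> `|u k - l| < e.
Proof.
move=> lam0 lam1 d0 Hu.
have L0 : 0 < 1 - lam by rewrite subr_gt0.
have D0 : 0 <= d / (1 - lam) by rewrite divr_ge0// ltW.
have Hd i j : `|u (i + j)%N - u i| <= lam ^+ i * (d / (1 - lam)).
  (* The difference of powers, kept in full, is what the induction on [j] can telescope. *)
  suff : `|u (i + j)%N - u i| <= d / (1 - lam) * (lam ^+ i - lam ^+ (i + j)).
    by move/le_trans; apply; rewrite mulrC ler_wpM2r// gerBl exprn_ge0.
  elim: j => [|j IH]; first by rewrite addn0 !subrr normr0 mulr0.
  rewrite -(subrKA (u (i + j)%N)) (le_trans (ler_normD _ _))//.
  rewrite addnS (le_trans (lerD (Hu _) IH))//.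
  rewrite exprS; move: (lam ^+ (i + j)) (lam ^+ i) => y x.
  by rewrite le_eqVlt; apply/orP; left; apply/eqP; field; rewrite gt_eqF.
have /cauchy_cvgP cu : cauchy (u @ \oo).
  apply/cauchy_exP => e e0; have [m H] := exprn_small lam0 lam1 D0 e0.
  exists (u m); exists m => // k /= mk; rewrite -ball_normE/= distrC -(subnKC mk).
  by apply: le_lt_trans (Hd _ _) _; exact: H.
exists (lim (u @ \oo)) => e e0; have /cvgrPdist_lt/(_ e e0)[m _ H] := cu.
by exists m => k mk; rewrite distrC; exact: H.
Qed.

End Orbits.

(** * Partitions by knots *)

Section Knots.
Context {R : realType} {n : nat}.
Variable x : 'rV[R]_n.-1.

Lemma knot_ord (j : 'I_n.-1) : knot x j.+1 = x ord0 j.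
Proof. by rewrite /knot insubT //= => jn; congr (x _ _); apply: val_inj. Qed.

Hypothesis n0 : (0 < n)%N.
Hypothesis xO : Omega x.

Lemma knot_last : knot x n = 1.
Proof. by case: n n0 x => // n' _ x'; rewrite /knot insubF//= ltnn. Qed.

Lemma knot_le k l : (k <= l)%N -> (l <= n)%N -> knot x k <= knot x l.
Proof.
move=> kl; rewrite -(subnKC kl); elim: (l - k)%N => [|j IH]; first by rewrite addn0.
rewrite addnS => jn; apply: le_trans (IH (ltnW jn)) _.
exact/ltW/xO.
Qed.

Lemma knot01 k : (k <= n)%N -> 0 <= knot x k <= 1.
Proof.
move=> kn; apply/andP; split; first by rewrite -[0]/(knot x 0) knot_le.
by rewrite -knot_last knot_le.
Qed.

Lemma coord_bounds (j : 'I_n.-1) : 0 < x ord0 j < 1.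
Proof.
have jn : (j.+1 < n)%N by have := ltn_ord j; lia.
rewrite -knot_ord; apply/andP; split.
  by apply: le_lt_trans (xO (ltnW jn)); case/andP: (knot01 (ltnW (ltnW jn))).
by apply: lt_le_trans (xO jn) _; case/andP: (knot01 jn).
Qed.

Lemma knot_locate_right y : 0 <= y < 1 ->
  exists i : 'I_n, knot x i <= y < knot x i.+1.
Proof.
move=> /andP[y0 y1].
have ex : exists k, y < knot x k by exists n; rewrite knot_last.
have kn : (ex_minn ex <= n)%N.
  by case: ex_minnP => k _; apply; rewrite knot_last.
case: ex_minnP kn => -[|k] /= yk kmin kn; first by move: yk; rewrite ltNge y0.
exists (Ordinal kn); rewrite /= yk andbT leNgt; apply/negP => /kmin.
by rewrite ltnn.
Qed.

Lemma knot_locate_left y : 0 < y <= 1 ->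
  exists i : 'I_n, knot x i < y <= knot x i.+1.
Proof.
move=> /andP[y0 y1].
have ex : exists k, y <= knot x k by exists n; rewrite knot_last.
have kn : (ex_minn ex <= n)%N.
  by case: ex_minnP => k _; apply; rewrite knot_last.
case: ex_minnP kn => -[|k] /= yk kmin kn; first by move: yk; rewrite leNgt y0.
exists (Ordinal kn); rewrite /= yk andbT ltNge; apply/negP => /kmin.
by rewrite ltnn.
Qed.

Variable I : 'I_n -> set R.
Hypothesis xI : knot_partition x I.

(** If [y] were outside [[a, b]], the open interval between [y] and the midpoint of [a] and [b]
    would lie in the interior of [J] and yet leave []a, b[]. *)
Lemma interval_sub_closure (J : set R) a b y : is_interval J -> a < b ->
  J° = `]a, b[%classic -> J y -> a <= y <= b.
Proof.
move=> iJ ab Jab Jy.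
have inJ z : a < z < b -> J z.
  by move=> zab; apply: interior_subset; rewrite Jab /= in_itv.
have Jin c d : J c -> J d -> c < d -> forall z, c < z < d -> a < z < b.
  move=> Jc Jd cd z zcd; have : J° z; last by rewrite Jab /= in_itv.
  have : `]c, d[ `<=` J°.
    rewrite -open_subsetE; last exact: interval_open.
    by move=> t /=; rewrite in_itv/= => /andP[ct td]; apply: (iJ c d) => //; rewrite !ltW.
  by apply; rewrite /= in_itv.
have Jm : J ((a + b) / 2) by apply: inJ; apply/andP; split; lra.
rewrite !leNgt; apply/andP; split; apply/negP => h.
- have yc : y < (a + b) / 2 by lra.
  have /andP[] : a < (a + y) / 2 < b; last by lra.
  by apply: (Jin _ _ Jy Jm yc); apply/andP; split; lra.
- have yc : (a + b) / 2 < y by lra.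
  have /andP[] : a < (b + y) / 2 < b; last by lra.
  by apply: (Jin _ _ Jm Jy yc); apply/andP; split; lra.
Qed.

Lemma piece_bounds i y : I i y -> knot x i <= y <= knot x i.+1.
Proof.
case: xI => iI intI _ _ Iy.
exact: interval_sub_closure (iI i) (xO (ltn_ord i)) (intI i) Iy.
Qed.

Lemma piece_interior (i : 'I_n) y : knot x i < y < knot x i.+1 -> I i y.
Proof.
by case: xI => _ intI _ _ yi; apply: interior_subset; rewrite intI /= in_itv.
Qed.

Lemma piece_cover y : 0 <= y < 1 -> exists i, I i y.
Proof.
case: xI => _ _ _ cov y01.
have : (\bigcup_i I i) y by rewrite cov /= in_itv.
by case=> i _ Iy; exists i.
Qed.

Lemma piece01 i y : I i y -> 0 <= y < 1.
Proof.
case: xI => _ _ _ cov Iy.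
have : (\bigcup_i I i) y by exists i.
by rewrite cov /= in_itv.
Qed.

(** Were [z] in another piece, a knot would lie between [y] and [z], hence at distance less than [d]
    from [y]. *)
Lemma piece_near i y z d : I i y -> 0 <= z < 1 -> `|y - z| < d ->
  (forall j, d <= `|x ord0 j - y|) -> I i z.
Proof.
move=> Iy z01 yz dx; have [i' Iz] := piece_cover z01.
have [/ord_inj -> //|ne] := eqVneq (i : nat) i'.
suff [j] : exists j : 'I_n.-1, Num.min y z <= x ord0 j <= Num.max y z.
  have := dx j; move: yz; rewrite ge_min le_max => h1 h2 /andP[h3 h4].
  exfalso; have := lt_le_trans h1 h2; rewrite ltNge => /negP; apply.
  rewrite ler_norml.
  have [yz|zy] := leP y z.
    rewrite (ler0_norm (x := y - z)) ?subr_le0//.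
    by move: h3 h4 => /orP[h3|h3] /orP[h4|h4]; apply/andP; split; lra.
  rewrite (gtr0_norm (x := y - z)) ?subr_gt0//.
  by move: h3 h4 => /orP[h3|h3] /orP[h4|h4]; apply/andP; split; lra.
have /andP[yl yr] := piece_bounds Iy; have /andP[zl zr] := piece_bounds Iz.
have [ii'|i'i|/ord_inj E] := ltngtP (i : nat) i'; last by rewrite E eqxx in ne.
- have jn : (i < n.-1)%N by have := ltn_ord i'; lia.
  exists (Ordinal jn); rewrite -knot_ord /= ge_min le_max yr /=.
  by rewrite (le_trans (knot_le ii' (ltnW (ltn_ord i'))) zl) orbT.
- have jn : (i' < n.-1)%N by have := ltn_ord i; lia.
  exists (Ordinal jn); rewrite -knot_ord /= ge_min le_max zr orbT /=.
  by rewrite (le_trans (knot_le i'i (ltnW (ltn_ord i))) yl).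
Qed.

(** A knot belongs to one of its two adjacent pieces; on that side the map follows the branch used
    at the knot itself. *)
Lemma piece_side i y : I i y ->
  exists (s : R) d, [/\ s = 1 \/ s = -1, 0 < d & forall z, 0 < s * (z - y) < d -> I i z].
Proof.
move=> Iy; have /andP[yl yr] := piece_bounds Iy.
have := xO (ltn_ord i); move: yr; rewrite le_eqVlt => /orP[/eqP yE|yr] lr.
- exists (-1), (knot x i.+1 - knot x i); split; [by right|by rewrite subr_gt0|].
  by move=> z /andP[z1 z2]; apply: piece_interior; apply/andP; split; lra.
- exists 1, (knot x i.+1 - y); split; [by left|by rewrite subr_gt0|].
  by move=> z /andP[z1 z2]; apply: piece_interior; apply/andP; split; lra.
Qed.

Lemma piece_at_side s y : s = 1 \/ s = -1 -> 0 <= y <= 1 ->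
  (forall z, 0 <= z < 1 -> s * (z - y) <= 0) \/
  exists i d, 0 < d /\ forall z, 0 < s * (z - y) < d -> I i z.
Proof.
move=> s1 /andP[y0 y1]; case: s1 => ->.
- move: y1; rewrite le_eqVlt => /orP[/eqP->|y1]; [left|right].
    by move=> z /andP[_ z1]; rewrite mul1r subr_le0 ltW.
  have [|i /andP[iy yi]] := @knot_locate_right y; first by rewrite y0.
  exists i, (knot x i.+1 - y); split; first by rewrite subr_gt0.
  by move=> z /andP[z1 z2]; apply: piece_interior; apply/andP; split; lra.
- move: y0; rewrite le_eqVlt => /orP[/eqP<-|y0]; [left|right].
    by move=> z /andP[z0 _]; rewrite mulN1r oppr_le0 subr0.
  have [|i /andP[iy yi]] := @knot_locate_left y; first by rewrite y0.
  exists i, (y - knot x i); split; first by rewrite subr_gt0.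
  by move=> z /andP[z1 z2]; apply: piece_interior; apply/andP; split; lra.
Qed.

End Knots.

(** * Dynamics of the piecewise contraction *)

Section Dynamics.
Context {R : realType} {n : nat}.
Variables (phi : 'I_n -> R -> R) (lam : R).
Hypothesis n0 : (0 < n)%N.
Hypothesis phi01 : forall i y, 0 <= y <= 1 -> 0 < phi i y < 1.
Hypotheses (lam0 : 0 <= lam) (lam1 : lam < 1).
Hypothesis phi_lam : forall i, contraction_on01 lam (phi i).
Hypothesis phi_mono :
  forall i, exists2 sg : R, sg = 1 \/ sg = -1 & strictly_monotone01 sg (phi i).

Definition level k : set R :=
  [set z | exists w t, [/\ size w = k, 0 <= t <= 1 & z = word_map phi w t]].

Lemma phi01w i y : 0 <= y <= 1 -> 0 <= phi i y <= 1.
Proof. by move=> /(phi01 i)/andP[y0 y1]; rewrite !ltW. Qed.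

Lemma level01 k z : level k z -> 0 <= z <= 1.
Proof. by case=> w [t [_ t01 ->]]; apply: word_map01 t01; exact: phi01w. Qed.

Lemma level0 z : 0 <= z <= 1 -> level 0 z.
Proof. by move=> z01; exists [::], z. Qed.

Lemma level_phi k i z : level k z -> level k.+1 (phi i z).
Proof.
case=> w [t [wk t01 ->]]; exists (rcons w i), t.
by rewrite size_rcons wk word_map_rcons.
Qed.

Lemma levelS k z : level k.+1 z -> level k z.
Proof.
case=> w [t [wk t01 ->]]; case: w wk => // i w [wk]; exists w, (phi i t).
by split=> //; exact: phi01w.
Qed.

Lemma level_le k l z : (k <= l)%N -> level l z -> level k z.
Proof.
move=> kl; rewrite -(subnKC kl); elim: (l - k)%N => [|j IH]; first by rewrite addn0.
by rewrite addnS => /levelS.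
Qed.

Lemma level_lt1 k z : (0 < k)%N -> level k z -> 0 <= z < 1.
Proof.
move=> k0 /(level_le k0)[w [t [w1 t01 ->]]]; case: w w1 => [|i []]//= _.
by have /andP[/ltW-> ->] := phi01 i t01.
Qed.

Lemma word_map_lipschitz w : contraction_on01 1 (word_map phi w).
Proof.
elim: w => [|i w IH] y z y01 z01 /=; first by rewrite mul1r.
have /le_trans := IH _ _ (phi01w i y01) (phi01w i z01); apply.
rewrite ler_wpM2l//.
by have /le_trans := @phi_lam i _ _ y01 z01; apply; rewrite ler_piMl// ltW.
Qed.

Lemma level_closed k : closed (level k).
Proof.
have -> : level k =
    \bigcup_(w in [set` words k]) (word_map phi w @` `[0, 1]%classic).
  apply/seteqP; split => [_ [w [t [wk t01 ->]]]|_ [w /= wk [t t01 <-]]].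
    exists w; first by rewrite /= mem_words wk.
    by exists t => //; rewrite /= in_itv.
  move: t01; rewrite /= in_itv/= => t01; exists w, t; split => //.
  by move: wk; rewrite mem_words => /eqP.
apply: closed_bigcup; first exact: finite_seq.
move=> w _; apply: compact_closed; first exact: Rhausdorff.
apply: continuous_compact; last exact: segment_compact.
apply/subspace_continuousP => y; rewrite /= in_itv/= => y01.
apply/cvgrPdist_le => e e0; rewrite near_withinE.
apply/nbhs_ballP; exists e => //= z; rewrite -ball_normE/= => yz.
rewrite in_itv/= => z01; have /le_trans := word_map_lipschitz w y01 z01; apply.
by rewrite mul1r ltW.
Qed.

Section Map.
Variables (x : 'rV[R]_n.-1) (I : 'I_n -> set R) (f : R -> R).
Hypothesis xO : Omega x.
Hypothesis xI : knot_partition x I.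
Hypothesis fI : forall i y, I i y -> f y = phi i y.

Lemma f01 y : 0 <= y < 1 -> 0 <= f y < 1.
Proof.
move=> y01; have [i Iy] := piece_cover xI y01; rewrite (fI Iy).
have /andP[y0 y1] := y01.
have /(phi01 i)/andP[h1 h2] : 0 <= y <= 1 by rewrite y0 ltW.
by rewrite ltW.
Qed.

Lemma iter_f01 k y : 0 <= y < 1 -> 0 <= iter k f y < 1.
Proof. by move=> y01; elim: k => //= k; exact: f01. Qed.

Lemma level_f k y : level k y -> 0 <= y < 1 -> level k.+1 (f y).
Proof.
by move=> ky y01; have [i Iy] := piece_cover xI y01; rewrite (fI Iy); exact: level_phi.
Qed.

Lemma level_iter k j y : level k y -> 0 <= y < 1 -> level (j + k) (iter j f y).
Proof.
move=> ky y01; elim: j => //= j IH.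
by apply: level_f => //; exact: iter_f01.
Qed.

Lemma lt1W (y : R) : 0 <= y < 1 -> 0 <= y <= 1.
Proof. by move=> /andP[-> /ltW]. Qed.

(** * Shadowing near a level that is far from the knots *)

Variables (K : nat) (d : R).
Hypotheses (K0 : (0 < K)%N) (d0 : 0 < d).
Hypothesis level_far : forall y, level K y -> forall j, d <= `|x ord0 j - y|.

Lemma shadow_step y z : level K y -> 0 <= z < 1 -> `|y - z| < d ->
  level K (f y) /\ `|f y - f z| <= lam * `|y - z|.
Proof.
move=> Ky z01 yz; have y01 := level_lt1 K0 Ky.
have [i Iy] := piece_cover xI y01.
have Iz := piece_near n0 xO xI Iy z01 yz (level_far Ky).
split; first by apply: levelS; exact: level_f.
by rewrite (fI Iy) (fI Iz); apply: phi_lam; exact: lt1W.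
Qed.

Lemma shadow y z k : level K y -> 0 <= z < 1 -> `|y - z| < d ->
  level K (iter k f y) /\ `|iter k f y - iter k f z| <= lam ^+ k * `|y - z|.
Proof.
move=> Ky z01 yz; elim: k => [|k [IH1 IH2]] /=; first by rewrite mul1r.
have [//||//|h1 h2] := @shadow_step (iter k f y) (iter k f z).
- exact: iter_f01.
- by apply: le_lt_trans IH2 (le_lt_trans _ yz); rewrite ler_piMl// exprn_ile1// ltW.
split=> //; apply: le_trans h2 _.
by rewrite exprS -mulrA ler_wpM2l.
Qed.

Lemma shadow_omega y z : level K y -> 0 <= z < 1 -> `|y - z| < d ->
  omega_limit f z = omega_limit f y.
Proof.
move=> Ky z01 yz; apply/esym/omega_limit_asymptotic => e e0.
have [m H] := exprn_small lam0 lam1 (normr_ge0 (y - z)) e0.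
exists m => k /H; apply: le_lt_trans.
by have [_] := shadow k Ky z01 yz.
Qed.

(** Let [z] be an orbit point in level [K] that returns [d]-close to itself after [p] steps.
    Shadowing bounds the steps of [u k], the [k * p]-th iterate of [z], by [d * lam ^+ k], so [u]
    converges, and its limit [q] is in level [K] by closedness. *)
Lemma omega_periodic y : 0 <= y < 1 -> exists q p,
  [/\ (0 < p)%N, level K q, iter p f q = q & omega_limit f y = omega_limit f q].
Proof.
move=> y01.
have lev k : level K (iter (k + K) f y).
  apply: level_le (leq_addl k K) _.
  by have := level_iter (k + K) (level0 (lt1W y01)) y01; rewrite addn0.
have [i [j [ij]]] := close_returns (fun k => lt1W (iter_f01 (k + K) y01)) d0.
pose z := iter (i + K) f y; pose p := (j - i)%N.
have p0 : (0 < p)%N by rewrite subn_gt0.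
have -> : iter (j + K) f y = iter p f z.
  by rewrite /z -iterD /p addnA subnK// ltnW.
rewrite -/z => zd.
have Kz : level K z by exact: lev.
have levz k : level K (iter k f z) by rewrite /z -iterD addnA; exact: lev.
have z01 := level_lt1 K0 Kz.
pose u k := iter (k * p) f z.
have u01 k : 0 <= u k < 1 by exact: iter_f01.
have uS k : u k.+1 = iter p f (u k) by rewrite /u -iterD mulSn.
have ustep k : `|u k.+1 - u k| <= d * lam ^+ k.
  rewrite distrC /u mulSn addnC iterD.
  have zd' : `|z - iter p f z| < d by rewrite distrC.
  have [_] := shadow (k * p) Kz (iter_f01 p z01) zd'.
  move/le_trans; apply; rewrite mulrC; apply: ler_pM => //.
  - exact: exprn_ge0.
  - exact: ltW.
  - by rewrite ler_wiXn2l// ?(ltW lam1)// leq_pmulr.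
have [q Hq] := geometric_step_cvg lam0 lam1 (ltW d0) ustep.
have Kq : level K q.
  apply: level_closed; apply/closureP_dist => e /Hq[m Hm].
  by exists (u m) => //; [exact: levz|rewrite distrC; exact: Hm].
have q01 := level_lt1 K0 Kq.
(* Shadowing of [q] by [u m] replaces continuity: [iter p f q] is close to [u m.+1], which is close
   to [q]. *)
have pq : iter p f q = q.
  apply/eqP; rewrite -subr_eq0 -normr_le0; apply/ler_addgt0Pr => e e0; rewrite add0r.
  have e2 : 0 < Num.min d (e / 2) by rewrite lt_min d0 divr_gt0.
  have [m Hm] := Hq _ e2.
  have := Hm m (leqnn m); rewrite distrC lt_min => /andP[qd qe].
  have [_ h1] := shadow p Kq (u01 m) qd.
  have := Hm m.+1 (leqnSn m); rewrite uS lt_min => /andP[_ h2].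
  have h3 : lam ^+ p * `|q - u m| <= `|q - u m|.
    by rewrite ler_piMl// exprn_ile1// ltW.
  rewrite -(subrKA (iter p f (u m))) (le_trans (ler_normD _ _))//.
  by move: (le_trans h1 h3) qe h2; lra.
have [m /(_ m (leqnn m)) Hm] := Hq _ d0.
exists q, p; split => //.
rewrite -(omega_limit_iter f (i + K) y) -/z -(omega_limit_iter f (m * p) z).
by apply: shadow_omega; [|exact: u01|rewrite distrC].
Qed.

(** The value of omega just to the right ([s = 1]) or left ([s = -1]) of [y]. If [[0, 1)] has no
    points there, every [v] qualifies. *)
Definition germ (s y : R) (v : set R) := exists2 e, 0 < e &
  forall z, 0 <= z < 1 -> 0 < s * (z - y) < e -> omega_limit f z = v.

Lemma norm_side (s t : R) : s = 1 \/ s = -1 -> 0 < s * t -> `|t| = s * t.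
Proof.
move=> s1 st; rewrite -(gtr0_norm st) normrM.
by case: s1 => ->; rewrite ?normrN normr1 mul1r.
Qed.

(* Downward induction on the level: the branch carries a one-sided
   neighbourhood of y to a one-sided neighbourhood of phi i y. *)
Lemma germ_level k s y : (k <= K)%N -> s = 1 \/ s = -1 -> level k y ->
  exists v, germ s y v.
Proof.
move=> kK; rewrite -(subKn kK); elim: (K - k)%N s y => [|j IH] s y s1 ky.
  rewrite subn0 in ky; exists (omega_limit f y), d => // z z01 /andP[sz0 sz1].
  by apply: shadow_omega; rewrite // distrC (norm_side s1).
have [triv|[i [e [e0 Hi]]]] := piece_at_side n0 xI s1 (level01 ky).
  by exists set0, 1 => // z /triv; rewrite leNgt => /negbTE->.
(* Subtraction is truncated: for [K <= j] both [K - j.+1] and [K - j] are 0. *)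
have [jK|Kj] := ltnP j K; last first.
  by apply: IH => //; rewrite (eqnP (leqW Kj)) in ky; rewrite (eqnP Kj).
have lev : level (K - j) (phi i y) by rewrite -subnSK//; exact: level_phi.
have [sg sg1 msg] := phi_mono i.
(* A decreasing branch exchanges left and right. *)
have sgs : sg * s = 1 \/ sg * s = -1.
  by case: sg1 => ->; case: s1 => ->; rewrite ?mulNr ?mul1r ?opprK; auto.
have [v [e' e'0 Hv]] := IH _ _ sgs lev.
exists v, (Num.min e e'); first by rewrite lt_min e0.
move=> z z01; rewrite lt_min => /andP[sz0 /andP[sze sze']].
have Iz : I i z by apply: Hi; rewrite sz0.
rewrite -(omega_limit_iter f 1 z) /= (fI Iz); apply: Hv.
  by rewrite -(fI Iz); exact: f01.
have y01 := level01 ky; have z01' := lt1W z01.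
have pos : 0 < sg * s * (phi i z - phi i y).
  case: s1 sz0 => ->; rewrite ?mulr1 ?mul1r ?mulN1r ?mulrN1 => sz0.
  - by apply: msg => //; rewrite -subr_gt0.
  - by rewrite mulNr -mulrN opprB; apply: msg => //; rewrite -subr_gt0 -opprB.
rewrite pos -(norm_side sgs pos)/=.
have /le_lt_trans := @phi_lam i _ _ z01' y01; apply.
by rewrite (norm_side s1 sz0); apply: le_lt_trans sze'; rewrite ler_piMl// ltW.
Qed.

(** * Counting the values of omega *)

Variables (vl vr : 'I_n.-1 -> set R).
Hypothesis vlP : forall j, germ (-1) (x ord0 j) (vl j).
Hypothesis vrP : forall j, germ 1 (x ord0 j) (vr j).

Section LocallyConstant.
Variable c : set R -> R.
Hypothesis c_knot : forall j, c (vl j) = c (vr j).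

Let cw y := c (omega_limit f y).

(** Downward induction again, now on both sides of [y]. Off the knots a whole neighbourhood follows
    one branch. At a knot one side follows the branch of [y], which identifies [cw y] with the germ
    value there; [c_knot] carries that value to the other side. *)
Lemma cw_level k y : (k <= K)%N -> level k y -> 0 <= y < 1 ->
  exists2 e, 0 < e & forall z, 0 <= z < 1 -> `|z - y| < e -> cw z = cw y.
Proof.
move=> kK; rewrite -(subKn kK); elim: (K - k)%N y => [|j IH] y ky y01.
  rewrite subn0 in ky; exists d => // z z01 zy.
  by rewrite /cw (shadow_omega ky z01)// distrC.
have [jK|Kj] := ltnP j K; last first.
  by apply: IH => //; rewrite (eqnP (leqW Kj)) in ky; rewrite (eqnP Kj).
have [i Iy] := piece_cover xI y01.
have lev : level (K - j) (phi i y) by rewrite -subnSK//; exact: level_phi.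
have [e e0 He] := IH _ lev (eq_ind _ (fun t => 0 <= t < 1) (f01 y01) _ (fI Iy)).
have cwf z : cw (f z) = cw z by rewrite /cw (omega_limit_iter f 1 z).
have near_piece z : I i z -> `|z - y| < e -> cw z = cw y.
  move=> Iz zy; have z01 := piece01 xI Iz.
  rewrite -(cwf z) -(cwf y) (fI Iz) (fI Iy); apply: He.
    by rewrite -(fI Iz); exact: f01.
  apply: le_lt_trans zy; have /le_trans := @phi_lam i _ _ (lt1W z01) (lt1W y01); apply.
  by rewrite ler_piMl// ltW.
have [[j0 yj]|noknot] := pselect (exists j0, y = x ord0 j0); last first.
  have pos j' : 0 < `|x ord0 j' - y|.
    by rewrite normr_gt0 subr_eq0; apply/eqP => E; apply: noknot; exists j'.
  have [d' d'0 Hd'] := finite_pos_lower_bound pos.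
  exists (Num.min d' e); first by rewrite lt_min d'0.
  move=> z z01; rewrite lt_min => /andP[zd ze]; apply: near_piece => //.
  by apply: (piece_near n0 xO xI Iy z01 _ Hd'); rewrite distrC.
have [s [d' [s1 d'0 Hd']]] := piece_side xO xI Iy.
have [vs [es es0 Hvs] cvs] : exists2 v, germ s y v & c v = c (vl j0).
  by case: s1 => ->; [exists (vr j0)|exists (vl j0)]; rewrite // yj.
have [vo [eo eo0 Hvo] cvo] : exists2 v, germ (- s) y v & c v = c (vl j0).
  by case: s1 => ->; [exists (vl j0)|exists (vr j0)]; rewrite // ?opprK yj.
have ss : s * s = 1 by case: s1 => ->; rewrite ?mulrNN mulr1.
(* The test point [y + s * h] is in the piece of [y], in the range of the germ and within [e] of
   [y], so it links [cw y] to [c (vl j0)]. *)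
pose h := Num.min (Num.min d' es) e / 2.
have h0 : 0 < h by rewrite divr_gt0// !lt_min d'0 es0.
have : h < Num.min (Num.min d' es) e.
  by rewrite /h ltr_pdivrMr// ltr_pMr ?ltr1n// !lt_min d'0 es0.
rewrite !lt_min => /andP[/andP[hd' hes] he].
have Ih : I i (y + s * h) by apply: Hd'; rewrite addrC addKr mulrA ss mul1r h0.
have cwy : cw y = c (vl j0).
  rewrite -cvs -(Hvs _ (piece01 xI Ih)).
    rewrite -/(cw _) near_piece// addrC addKr normrM (gtr0_norm h0).
    by case: s1 => ->; rewrite ?normrN normr1 mul1r.
  by rewrite addrC addKr mulrA ss mul1r h0.
exists (Num.min d' (Num.min e eo)); first by rewrite !lt_min d'0 e0.
move=> z z01; rewrite !lt_min => /andP[zd /andP[ze zo]].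
have [->//|zy] := eqVneq z y.
have sgnz : 0 < s * (z - y) \/ 0 < (- s) * (z - y).
  case: s1 => ->; rewrite ?opprK ?mul1r ?mulN1r ?oppr_gt0 ?subr_gt0 ?subr_lt0;
  by case: (ltgtP z y) zy => // _ _; auto.
case: sgnz => sz.
  by apply: near_piece => //; apply: Hd'; rewrite sz -(norm_side s1 sz).
have ns1 : - s = 1 \/ - s = -1 by case: s1 => ->; rewrite ?opprK; auto.
rewrite cwy -cvo /cw (Hvo z z01)//.
by rewrite sz -(norm_side ns1 sz).
Qed.

(** Being locally constant on [[0, 1)], which lies in level 0, [cw] has derivative 0 there and is
    therefore Lipschitz with constant 0. *)
Lemma cw_constant y z : 0 <= y < 1 -> 0 <= z < 1 -> cw y = cw z.
Proof.
move=> y01 z01; apply/eqP; rewrite -subr_eq0 -normr_le0 -[X in _ <= X](mul0r `|y - z|).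
have iJ := @interval_is_interval R `[0, 1[%R.
apply: (is_derive_within_lipschitz (f1 := fun=> 0) iJ); rewrite ?/= ?in_itv//=.
- move=> t; rewrite in_itv/= => t01; apply/is_derive_withinP => e e0.
  have [e' e'0 H] := cw_level (leq0n K) (level0 (lt1W t01)) t01.
  exists e' => // s; rewrite /= in_itv/= => s01 st.
  by rewrite (H s s01 st) subrr mul0r subrr normr0 mulr_ge0// ltW.
- by move=> t _; rewrite normr0.
Qed.

End LocallyConstant.

(* The rows of the matrix are indexed by r values of omega; a vector in its left
   kernel is a function of these values that does not jump across any knot, and
   such a function is constant. *)
Lemma omega_count r (g : 'I_r -> set R) : injective g ->
  (forall a, exists2 y, 0 <= y < 1 & omega_limit f y = g a) -> (r <= n)%N.
Proof.
move=> ginj gw.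
pose M : 'M[R]_(r, n.-1) := \matrix_(a, j) (`[< g a = vl j >]%:R - `[< g a = vr j >]%:R).
have ker_const (u : 'rV[R]_r) : (u <= kermx M)%MS -> forall a b, u ord0 a = u ord0 b.
  move=> /sub_kermxP uM.
  (* The function with value [u a] at [g a] and 0 at all sets outside the family; column [j] of [M]
     states that it does not jump at knot [j]. *)
  pose c v := \sum_a u ord0 a * `[< g a = v >]%:R.
  have ck j : c (vl j) = c (vr j).
    have /matrixP/(_ ord0 j) := uM; rewrite !mxE => H.
    apply/eqP; rewrite -subr_eq0 /c -sumrB -{2}H; apply/eqP.
    by apply: eq_bigr => a _; rewrite mxE mulrBr.
  have cg a : c (g a) = u ord0 a.
    rewrite /c (bigD1 a)//= asboolT// mulr1 big1 ?addr0// => b ba.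
    rewrite asboolF ?mulr0// => /ginj E; by rewrite E eqxx in ba.
  move=> a b; rewrite -!cg.
  have [y y01 <-] := gw a; have [z z01 <-] := gw b.
  exact: cw_constant.
have kle : (kermx M <= (const_mx 1 : 'rV[R]_r))%MS.
  apply/row_subP => i; have := ker_const _ (row_sub i (kermx M)).
  move: (row i _) => u; case: r {M ginj gw g ker_const i} u => [|r'] u Hu.
    by rewrite thinmx0 sub0mx.
  apply/sub_rVP; exists (u ord0 ord0); apply/rowP => a.
  by rewrite !mxE mulr1 (Hu a ord0).
(* The kernel has dimension [r - rank M], which is at most 1, while [rank M <= n.-1]. *)
have := mxrankS kle; rewrite mxrank_ker => /leq_trans/(_ (rank_leq_row _)).
have := rank_leq_col M; lia.
Qed.

End Map.

End Dynamics.

(** * Almost every knot vector *)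

(** A bound on injective families of values gives a largest one; a value missing from it could be
    added. *)
Lemma maximal_injective_family (T U : Type) (w : T -> U) (D : set T) (N : nat) :
  D !=set0 ->
  (forall r (g : 'I_r -> U), injective g ->
    (forall a, exists2 y, D y & w y = g a) -> (r <= N)%N) ->
  exists r (g : 'I_r -> U), [/\ (1 <= r <= N)%N, injective g,
    forall a, exists2 y, D y & w y = g a & forall y, D y -> exists a, w y = g a].
Proof.
move=> [y0 Dy0] bound.
pose P r := `[< exists g : 'I_r -> U,
  injective g /\ forall a, exists2 y, D y & w y = g a >].
have P1 : P 1%N.
  apply/asboolP; exists (fun=> w y0); split; last by exists y0.
  by move=> a b _; rewrite !ord1.
have PN r : P r -> (r <= N)%N by move=> /asboolP[g [ginj gw]]; exact: bound gw.
case: (ex_maxnP (ex_intro P _ P1) PN) => r Pr rmax.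
have /asboolP[g [ginj gw]] := Pr.
exists r, g; split => //; first by rewrite (rmax _ P1) (PN _ Pr).
move=> y Dy; apply: contrapT => H.
suff : P r.+1 by move=> /rmax; rewrite ltnn.
apply/asboolP; exists (fun a => if unlift ord0 a is Some b then g b else w y).
split=> [a b|a]; last by case: unliftP => [b _|_]; [exact: gw|exists y].
case: unliftP => [a' ->|->]; case: unliftP => [b' ->|->] //.
- by move=> /ginj ->.
- by move=> E; case: H; exists a'.
- by move=> E; case: H; exists b'.
Qed.

Section Generic.
Context {R : realType} {n : nat}.
Variables (phi : 'I_n -> R -> R) (lam : R).
Hypothesis n0 : (0 < n)%N.
Hypothesis phi01 : forall i y, 0 <= y <= 1 -> 0 < phi i y < 1.
Hypotheses (lam0 : 0 <= lam) (lam1 : lam < 1).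
Hypothesis phi_lam : forall i, contraction_on01 lam (phi i).
Hypothesis phi_mono :
  forall i, exists2 sg : R, sg = 1 \/ sg = -1 & strictly_monotone01 sg (phi i).

(** The condition on the coordinates involves the branches only, so one exceptional set serves all
    the maps associated with [x]. Stability holds because the periodic orbits stay in level [K], at
    distance at least [d] from the knots. *)
Lemma stable_periodic_dynamics (x : 'rV[R]_n.-1) (f : R -> R) :
  Omega x -> (forall j, exists k, ~ level phi k (x ord0 j)) ->
  associated_map phi x f ->
  exists (r : nat) (gamma : 'I_r -> set R),
    [/\ (1 <= r <= n)%N, injective gamma,
        forall j, stable_periodic_orbit x f (gamma j) &
        forall y, y \in `[0, 1[ -> exists j, omega_limit f y = gamma j].
Proof.
move=> xO /choice[k xk] [I xI fI].
(* The successor makes [K] positive, so that level [K] lies in [[0, 1)]. *)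
pose K := (\max_j k j).+1.
have farK j : ~ level phi K (x ord0 j).
  by move=> /(level_le phi01 (leqW (leq_bigmax j)))/xk.
have /choice[dd ddP] j :
    exists d, 0 < d /\ forall y, level phi K y -> d <= `|x ord0 j - y|.
  have [d d0 dP] := closed_dist (level_closed phi01 lam1 phi_lam (k := K)) (farK j).
  by exists d.
have [d d0 dle] := finite_pos_lower_bound (fun j => (ddP j).1).
have far y : level phi K y -> forall j, d <= `|x ord0 j - y|.
  by move=> Ky j; apply: le_trans (dle j) _; exact: (ddP j).2.
have germs s j : s = 1 \/ s = -1 -> exists v, germ f s (x ord0 j) v.
  move=> s1; apply: (germ_level n0 phi01 lam0 lam1 phi_lam phi_mono xO xI fI
    (ltn0Sn _) d0 far (leq0n K) s1).
  by apply: level0; have /andP[/ltW-> /ltW->] := coord_bounds n0 xO j.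
have /choice[vl vlP] j := germs (-1) j (or_intror erefl).
have /choice[vr vrP] j := germs 1 j (or_introl erefl).
have D0 : [set y : R | 0 <= y < 1] !=set0 by exists 0; rewrite /= lexx ltr01.
have count r (g : 'I_r -> set R) : injective g ->
    (forall a, exists2 y : R, 0 <= y < 1 & omega_limit f y = g a) -> (r <= n)%N.
  exact: (omega_count n0 phi01 lam0 lam1 phi_lam xO xI fI (ltn0Sn _) d0 far vlP vrP).
have [r [g [rn ginj gw wg]]] := maximal_injective_family D0 count.
exists r, g; split => //.
move=> a; have [y y01 <-] := gw a.
have [q [p [p0 Kq pq ->]]] :=
  omega_periodic n0 phi01 lam0 lam1 phi_lam xO xI fI (ltn0Sn _) d0 far y01.
have q01 := level_lt1 phi01 (ltn0Sn _) Kq.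
rewrite (omega_limit_periodic p0 pq); split.
  by exists q, p; rewrite in_itv.
move=> _ [j _ <-]; split; first by rewrite /= in_itv; exact: (iter_f01 phi01 xI fI).
move=> [l _ xl].
have Kj : level phi K (iter j f q).
  apply: (level_le phi01 (leq_addl j K)).
  exact: (level_iter phi01 xI fI).
by have := far _ Kj l; rewrite xl subrr normr0 leNgt d0.
Qed.

End Generic.

Theorem theorem1p1 (R : realType) (n : nat) (A : 'I_n -> set R)
    (phi : 'I_n -> R -> R) :
  (2 <= n)%N ->
  (forall i, [/\ is_interval (A i), compact (A i) & A i `<=` `]0, 1[]) ->
  trivIset setT A ->
  (forall i, C2_diffeo `[0, 1] (A i) (phi i)) ->
  (forall i, (ereal_sup [set `|(phi i)^`()%classic x|%:E | x in `]0%R, 1%R[] < 1)%E) ->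
  lebesgue_ae_in (@Omega R n) (fun x =>
    forall f : R -> R, associated_map phi x f ->
    exists (r : nat) (gamma : 'I_r -> set R),
      [/\ (1 <= r <= n)%N,
          injective gamma,
          forall j, stable_periodic_orbit x f (gamma j) &
          forall y, y \in `[0, 1[ -> exists j, omega_limit f y = gamma j]).
Proof.
move=> n2 A_prop A_disj diffeo sup1.
have n0 : (0 < n)%N by exact: ltnW.
have m0 : (0 < n.-1)%N by rewrite -ltnS prednK.
have phiA i y : 0 <= y <= 1 -> A i (phi i y).
  by move=> y01; have [[+ _ _] _ _] := diffeo i; apply; rewrite /= in_itv.
have phi01 i y : 0 <= y <= 1 -> 0 < phi i y < 1.
  by move=> /(phiA i) Ay; have [_ _ /(_ _ Ay)] := A_prop i; rewrite /= in_itv.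
have phi_mono i := branch_monotone (diffeo i).
have /choice[ll llP] i := branch_contraction (diffeo i) (sup1 i).
have [e e0 ele] : exists2 e, 0 < e & forall i, e <= 1 - ll i.
  by apply: finite_pos_lower_bound => i; have [_ h _] := llP i; rewrite subr_gt0.
pose lam := 1 - e.
have lam0 : 0 <= lam.
  by have [h _ _] := llP (Ordinal n0); have := ele (Ordinal n0); rewrite /lam; lra.
have lam1 : lam < 1 by rewrite /lam; lra.
have phi_lam i : contraction_on01 lam (phi i).
  move=> y z y01 z01; have [_ _ h] := llP i; apply: le_trans (h y z y01 z01) _.
  by rewrite ler_wpM2r//; have := ele i; rewrite /lam; lra.
have /choice[CC CCP] i : exists C, 0 <= C /\ distortion01 (fun d => 1 + C * d) (phi i).
  have [iA cA _] := A_prop i; have [C C0 CP] := branch_distortion iA cA (diffeo i).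
  by exists C.
have [C C0 Cle] := finite_upper_bound CC 0.
have phi_dist i : distortion01 (fun d => 1 + C * d) (phi i).
  move=> s t y z u v s0 t1 yst zst ust vst.
  apply: le_trans ((CCP i).2 _ _ _ _ _ _ s0 t1 yst zst ust vst) _.
  rewrite ler_wpM2r ?mulr_ge0// lerD2l ler_wpM2r//.
  by move: yst; lra.
have z01 : 0 <= (0 : R) <= 1 by rewrite lexx ler01.
have o01 : 0 <= (1 : R) <= 1 by rewrite lexx ler01.
pose lo i := Num.min (phi i 0) (phi i 1); pose hi i := Num.max (phi i 0) (phi i 1).
have Alo i : A i (lo i) by rewrite /lo minElt; case: ifP => _; exact: phiA.
have Ahi i : A i (hi i) by rewrite /hi maxElt; case: ifP => _; exact: phiA.
have lohi i : lo i <= hi i by rewrite /lo /hi ge_min le_max lexx.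
have A01 i y : A i y -> 0 < y < 1.
  by have [_ _ h] := A_prop i => /h; rewrite /= in_itv.
have [delta delta0 dlo] : exists2 d, 0 < d & forall i, d <= lo i.
  by apply: finite_pos_lower_bound => i; have /andP[] := A01 _ _ (Alo i).
have delta1 : delta <= 1.
  apply: le_trans (dlo (Ordinal n0)) _.
  by have /andP[_ /ltW] := A01 _ _ (Alo (Ordinal n0)).
have phi_delta i y : 0 <= y <= 1 -> delta <= phi i y.
  move=> y01; have [sg sg1 mg] := phi_mono i.
  apply: le_trans (dlo i) _.
  by have /andP[] := monotone01_between sg1 mg (lexx 0) (lexx 1) y01.
have phi_sep i j : i != j -> hi i < lo j \/ hi j < lo i.
  move=> ij; have [|ji] := ltP (hi i) (lo j); first by left.
  have [|ji'] := ltP (hi j) (lo i); first by right.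
  exfalso; move/eqP: ij; apply.
  (* If the hulls overlapped, the larger of their left end points would lie in both [A i] and
     [A j]. *)
  apply: (A_disj i j I I); exists (Num.max (lo i) (lo j)); split.
  - have [iA _ _] := A_prop i; apply: (iA (lo i) (hi i)) => //.
    by rewrite le_max lexx ge_max lohi.
  - have [iA _ _] := A_prop j; apply: (iA (lo j) (hi j)) => //.
    by rewrite le_max lexx orbT ge_max lohi ji'.
apply: lebesgue_outer_slabs => //.
  by move=> x [xO _] j; have /andP[/ltW-> /ltW->] := coord_bounds n0 xO j.
move=> e' e'0.
have [k Hk] := sum_word_length_cvg0 (phi01w phi01) phi_mono lam1 C0
  phi_lam phi_dist delta0 delta1 phi_delta phi_sep e'0.
pose wlo w := Num.min (word_map phi w 0) (word_map phi w 1).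
pose whi w := Num.max (word_map phi w 0) (word_map phi w 1).
exists [seq (wlo w, whi w) | w <- words k]; split.
- by move=> _ /mapP[w _ ->] /=; rewrite ge_min le_max lexx.
- rewrite big_map /=; apply: le_lt_trans Hk; apply: ler_sum => w _.
  rewrite /word_length /wlo /whi maxElt minElt; case: ltP => h.
    by rewrite gtr0_norm ?subr_gt0.
  by rewrite ler0_norm ?opprB ?subr_le0.
(* If no coordinate of [x] meets these intervals, none is in level [k], and the dynamics is as
   claimed for every [f]. *)
- move=> x [xO xbad]; apply: contrapT => H; apply: xbad => f.
  apply: (stable_periodic_dynamics n0 phi01 lam0 lam1 phi_lam phi_mono xO) => j.
  exists k => -[w [t [wk t01 xw]]]; apply: H; exists j, (wlo w, whi w); split.
    by apply: map_f; rewrite mem_words wk.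
  have [sg sg1 mg] := word_map_mono (phi01w phi01) phi_mono w.
  by rewrite xw /=; exact: monotone01_between sg1 mg (lexx 0) (lexx 1) t01.
Qed.
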